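(* Let $G$ be a finite simple graph and $e \in E(G)$. Then $\gamma_{gr}^L(G) - 1 \leq \gamma_{gr}^L(G - e) \leq \gamma_{gr}^L(G) + 2$, where $G - e$ is the graph obtained from $G$ by deleting the edge $e$.
   Context: For a vertex $v$, $N(v)$ is its open neighborhood (the set of its neighbors) and $N[v] = N(v) \cup \{v\}$ its closed neighborhood. An L-sequence of a graph $G$ is a sequence $(v_1, \ldots, v_k)$ of distinct vertices of $G$ such that for every $i \in \{1,\ldots,k\}$, $N[v_i] \setminus \bigcup_{j=1}^{i-1} N(v_j) \neq \emptyset$. The L-Grundy domination number $\gamma_{gr}^L(G)$ is the maximum length of an L-sequence of $G$. *)

(* Defs.v *)
From mathcomp Require Import all_boot.

Set Implicit Arguments.
Unset Strict Implicit.
Unset Printing Implicit Defensive.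

Record sgraph := SGraph {
  vertex :> finType;
  adj : rel vertex;
  adj_sym : symmetric adj;
  adj_irr : irreflexive adj }.

(* An edge is the unordered pair [set x; y] of its ends. *)
Definition edges (G : sgraph) : {set {set G}} :=
  [set A : {set G} | [exists x, exists y, adj x y && (A == [set x; y])]].

Section DeleteEdge.
Variables (G : sgraph) (e : {set G}).

Definition del_edge_rel : rel G :=
  fun x y => adj x y && ([set x; y] != e).

Lemma del_edge_sym : symmetric del_edge_rel.
Proof. by move=> x y; rewrite /del_edge_rel adj_sym setUC. Qed.

Lemma del_edge_irr : irreflexive del_edge_rel.
Proof. by move=> x; rewrite /del_edge_rel adj_irr. Qed.

Definition del_edge : sgraph := SGraph del_edge_sym del_edge_irr.

End DeleteEdge.

Definition open_nbh (G : sgraph) (v : G) : {set G} := [set u | adj v u].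

Definition closed_nbh (G : sgraph) (v : G) : {set G} := v |: open_nbh v.

Definition L_sequence (G : sgraph) (k : nat) (s : k.-tuple G) : bool :=
  uniq s &&
  [forall i : 'I_k,
     closed_nbh (tnth s i)
       :\: \bigcup_(j : 'I_k | j < i) open_nbh (tnth s j) != set0].

(* Entries are distinct, so lengths are at most #|G|; the empty sequence
   makes the maximum range over a nonempty set. *)
Definition L_grundy (G : sgraph) : nat :=
  \max_(k < #|G|.+1 | [exists s : k.-tuple G, L_sequence s]) k.

Lemma L_sequence_le_grundy (G : sgraph) (k : nat) (s : k.-tuple G) :
  L_sequence s -> k <= L_grundy G.
Proof.
move=> Ls; have ltk : k < #|G|.+1.
  have /andP[us _] := Ls.
  by rewrite ltnS -(size_tuple s) -(card_uniqP us) max_card.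
apply: (leq_bigmax_cond (F := fun i : 'I_#|G|.+1 => i : nat) (Ordinal ltk)).
by apply/existsP; exists s.
Qed.

Lemma L_grundy_attained (G : sgraph) :
  exists s : (L_grundy G).-tuple G, L_sequence s.
Proof.
have P0 : [exists s : 0.-tuple G, L_sequence s].
  apply/existsP; exists [tuple]; rewrite /L_sequence /=.
  by apply/forallP => -[].
have ne : 0 < #|[pred k : 'I_#|G|.+1 | [exists s : k.-tuple G, L_sequence s]]|.
  by apply/card_gt0P; exists ord0.
have [k Pk ek] := eq_bigmax_cond (fun i : 'I_#|G|.+1 => i : nat) ne.
by move: Pk; rewrite /L_grundy ek => /existsP.
Qed.

(* Main.v *)
Require Import Defs.
From mathcomp Require Import all_boot.

Set Implicit Arguments.
Unset Strict Implicit.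
Unset Printing Implicit Defensive.

(** Record with an L-sequence a map [f] sending each entry [v] to a vertex [f v]
    of [N[v]] that no earlier entry is adjacent to; a subsequence keeps the same
    witnesses. Let [e = xy]. Dropping [x] and [y] from a sequence of [G - e] gives
    a sequence of [G], since the other neighborhoods agree. Conversely, given a
    sequence of [G], deleting [x] suffices unless [f y = x], and deleting [y]
    suffices unless [f x = y]. If both hold and, say, [x] precedes [y], then no
    entry before [y] is adjacent to [x], so [x] is its own witness and [y] can be
    deleted. *)

Definition footprinting (G : sgraph) (s : seq G) (f : G -> G) : bool :=
  [&& uniq s, all (fun v => f v \in closed_nbh v) s
    & pairwise (fun w v => ~~ adj w (f v)) s].

Lemma in_closed_nbh (G : sgraph) (v u : G) :
  (u \in closed_nbh v) = (u == v) || adj v u.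
Proof. by rewrite !inE. Qed.

Lemma footprinting_le_grundy (G : sgraph) (s : seq G) (f : G -> G) :
  footprinting s f -> size s <= L_grundy G.
Proof.
case/and3P=> us /allP cs ps.
apply: (@L_sequence_le_grundy _ _ (in_tuple s)); rewrite /L_sequence us /=.
apply/forallP=> i; apply/set0Pn.
have x0 : G by case: s i {us cs ps} => [[] //|].
exists (f (tnth (in_tuple s) i)); rewrite inE cs ?mem_tnth // andbT.
apply/bigcupP=> -[j ltji]; rewrite inE; apply/negP.
rewrite !(tnth_nth x0); move/(pairwiseP x0): ps; apply => //; exact: ltn_ord.
Qed.

Lemma grundy_footprinting (G : sgraph) :
  exists s : seq G, exists2 f, footprinting s f & size s = L_grundy G.
Proof.
have [s /andP[us /forallP Ls]] := L_grundy_attained G.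
pose cov i := \bigcup_(j < L_grundy G | j < i) open_nbh (tnth s j).
(* Entries are distinct, so [index] recovers the position of [v] and a map on vertices suffices; on
   entries of [s] the default [v] is never reached, by [Ls]. *)
pose f v := odflt v [pick u in closed_nbh v :\: cov (index v s)].
have fP i : f (tnth s i) \in closed_nbh (tnth s i) :\: cov i.
  have ei : index (tnth s i) s = i.
    by rewrite (tnth_nth (tnth s i)) index_uniq ?size_tuple.
  rewrite /f ei; case: pickP => [//|none].
  by have /set0Pn[u] := Ls i; rewrite -/(cov i) none.
exists s, f; rewrite ?size_tuple //; apply/and3P; split=> //.
  by apply/allP=> v /tnthP[i ->]; have := fP i; rewrite inE => /andP[].
case: (posnP (L_grundy G)) => [g0|g_gt0].
  by have/size0nil-> : size s = 0 by rewrite size_tuple.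
apply/(pairwiseP (tnth s (Ordinal g_gt0))) => i j.
rewrite -!topredE /= size_tuple => lti ltj ltij.
rewrite -(tnth_nth _ s (Ordinal lti)) -(tnth_nth _ s (Ordinal ltj)).
have := fP (Ordinal ltj); rewrite inE => /andP[/bigcupP ncov _].
by apply/negP=> a; apply: ncov; exists (Ordinal lti); rewrite ?inE.
Qed.

Section EdgeDeletion.
Variables (G : sgraph) (e : {set G}).

Lemma del_edge_sub (v u : G) : @adj (del_edge e) v u -> adj v u.
Proof. by case/andP. Qed.

Lemma del_edge_off (v u : G) : v \notin e -> @adj (del_edge e) v u = adj v u.
Proof.
move=> ve; rewrite /= /del_edge_rel andb_idr // => _.
by apply: contraNneq ve => <-; rewrite set21.
Qed.

(** A neighbor [u] of [v] is lost only if [{v, u} = e]; as [v] is not [y], this forces [v = x] and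
    [u = y]. *)
Lemma closed_nbh_del_edge (x y v u : G) : e = [set x; y] -> v != y ->
  (v = x -> u != y) -> u \in closed_nbh v ->
  (u : del_edge e) \in closed_nbh (v : del_edge e).
Proof.
move=> -> vy vx; rewrite !in_closed_nbh; case/orP=> [/eqP->|a]; first by rewrite eqxx.
apply/orP; right; rewrite /= /del_edge_rel a /=; apply/eqP=> /setP E.
have /eqP v_x : v == x by have := E v; rewrite !inE eqxx (negPf vy) orbF.
by have := E y; rewrite !inE eqxx orbT eq_sym (negPf vy) eq_sym (negPf (vx v_x)).
Qed.

(** Deleting an edge shrinks open neighborhoods, so non-adjacency to later witnesses survives. Once
    [y] is removed, only [x] could lose its witness, and only if that witness is [y]. *)
Lemma footprinting_rem (x y : G) (s : seq G) (f : G -> G) :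
  e = [set x; y] -> footprinting s f -> (x \in s -> f x != y) ->
  size s - 1 <= L_grundy (del_edge e).
Proof.
move=> exy /and3P[us /allP cs ps] fxy.
have: footprinting (rem y s : seq (del_edge e)) f.
  apply/and3P; split; first exact: rem_uniq.
    apply/allP=> v; rewrite mem_rem_uniq // => /andP[/= vy vs].
    by apply: closed_nbh_del_edge exy vy _ (cs v vs) => vx; rewrite vx fxy -?vx.
  apply: sub_pairwise (subseq_pairwise (rem_subseq y s) ps) => w v.
  exact/contra/del_edge_sub.
move/footprinting_le_grundy; apply: leq_trans.
by case ys: (y \in s); [rewrite size_rem // subn1 | rewrite rem_id ?ys ?leq_subr].
Qed.

Lemma footprinting_swap (x y : G) (s1 s2 : seq G) (f : G -> G) :
  e = [set x; y] -> x != y -> footprinting (s1 ++ x :: s2) f -> y \in s2 ->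
  f y = x -> size (s1 ++ x :: s2) - 1 <= L_grundy (del_edge e).
Proof.
move=> exy xy /and3P[us cs ps] ys fyx.
(* Make [x] its own witness: since [x] differs from [y], [footprinting_rem] then applies to [g]. *)
pose g v := if v == x then x else f v.
have gE : {in s1 ++ s2, g =1 f}.
  move=> v; rewrite /g; case: eqP => // -> xs; move: us.
  by rewrite uniq_catC cat_cons cons_uniq mem_cat orbC -mem_cat xs.
apply: (@footprinting_rem x y _ g) => //; last by rewrite /g eqxx.
apply/and3P; split=> //.
  apply/allP=> v vs; rewrite /g; case: eqP => [->|_]; last exact: (allP cs).
  by rewrite in_closed_nbh eqxx.
move: ps; rewrite !pairwise_cat !allrel_consr /=.
case/and3P=> /andP[_ /allrelP a12] p1 /andP[/allP ax p2].
have sub1 : {subset s1 <= s1 ++ s2} by move=> v vs; rewrite mem_cat vs.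
have sub2 : {subset s2 <= s1 ++ s2} by move=> v vs; rewrite mem_cat vs orbT.
have same (r : seq G) : {subset r <= s1 ++ s2} ->
    pairwise (fun w v => ~~ adj w (g v)) r = pairwise (fun w v => ~~ adj w (f v)) r.
  move=> sub; apply: (@eq_in_pairwise _ (mem (s1 ++ s2))); last exact/allP.
  by move=> w v _ vs /=; rewrite gE.
rewrite !same // p1 p2 andbT -andbA; apply/and3P; split.
(* Entries before [x] also precede [y], whose witness is [x], so none of them is adjacent to [x]. *)
- by apply/allP=> w ws; rewrite /g eqxx -fyx a12.
- by apply/allrelP=> w v ws vs; rewrite gE ?sub2 // a12.
- by apply/allP=> v vs; rewrite gE ?sub2 // ax.
Qed.

End EdgeDeletion.

Lemma L_grundy_del_edge_ge (G : sgraph) (x y : G) :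
  x != y -> L_grundy G - 1 <= L_grundy (del_edge [set x; y]).
Proof.
move=> xy; have [s [f fs <-]] := grundy_footprinting G.
have [xs|xs] := boolP (x \in s); last first.
  by apply: footprinting_rem fs _ => // xs'; rewrite xs' in xs.
have [ys|ys] := boolP (y \in s); last first.
  by apply: (footprinting_rem (setUC _ _) fs) => ys'; rewrite ys' in ys.
have [fxy|fxy] := eqVneq (f x) y; last by apply: footprinting_rem fs _.
have [fyx|fyx] := eqVneq (f y) x; last first.
  by apply: (footprinting_rem (setUC _ _) fs).
(* Each end is now the witness of the other, so their order decides: the later one is removed. *)
case/splitPr: xs fs ys => s1 s2 fs.
rewrite mem_cat in_cons eq_sym (negPf xy) /= => /orP[] ys; last first.
  exact: footprinting_swap fs ys fyx.
case/splitPr: ys fs => s3 s4; rewrite -catA => fs.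
apply: (footprinting_swap (setUC _ _) _ fs _ fxy); first by rewrite eq_sym.
by rewrite mem_cat mem_head orbT.
Qed.

(** Entries are distinct, so discarding those in [e] costs at most [#|e|]; the rest form a sequence
    of [G] with the same witnesses. *)
Lemma L_grundy_del_edge_le (G : sgraph) (e : {set G}) :
  L_grundy (del_edge e) <= L_grundy G + #|e|.
Proof.
have [s [f /and3P[us cs ps] <-]] := grundy_footprinting (del_edge e).
rewrite -(count_predC (mem e) s) addnC leq_add //; last first.
  rewrite -size_filter -(card_uniqP (filter_uniq _ us)); apply/subset_leq_card.
  by apply/subsetP=> v; rewrite mem_filter => /andP[].
rewrite -size_filter; apply: (@footprinting_le_grundy G _ f).
apply/and3P; split; first exact: filter_uniq.
  apply/allP=> v; rewrite mem_filter => /andP[_ /(allP cs)].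
  by rewrite !in_closed_nbh => /orP[/eqP->|/del_edge_sub->];
    rewrite ?eqxx ?orbT.
(* Only the earlier entry [w] has to avoid [e]: its neighbors are then the same in both graphs,
   wherever the witness [f v] lies. *)
rewrite -(@eq_in_pairwise _ (predC (mem e)) (fun w v => ~~ @adj (del_edge e) w (f v))).
- exact: subseq_pairwise (filter_subseq _ _) ps.
- by move=> w v we _ /=; rewrite -(del_edge_off _ we).
- exact: filter_all.
Qed.

Theorem theorem4p1 (G : sgraph) (e : {set G}) (he : e \in edges G) :
  L_grundy G - 1 <= L_grundy (del_edge e) <= L_grundy G + 2.
Proof.
move: he; rewrite inE => /existsP[x /existsP[y /andP[axy /eqP ->]]].
have xy : x != y by apply: contraTneq axy => ->; rewrite adj_irr.
rewrite L_grundy_del_edge_ge //=; apply: leq_trans (L_grundy_del_edge_le _) _.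
by rewrite cards2 xy.
Qed.
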